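(* Let $V$ be a non-trivial irreducible Harish-Chandra module over the full toroidal Lie algebra $\tau$. Then $V$ is either a cuspidal module or, up to a change of co-ordinates, a GHW (generalized highest weight) module.
   Context: All vector spaces are over $\mathbb{C}$; $n\geqslant 1$ is an integer; $\mathbb N$ is the set of positive integers; $\mathfrak{g}$ is a finite-dimensional simple Lie algebra with a symmetric non-degenerate invariant bilinear form $(\cdot|\cdot)$. Let $A=\mathbb{C}[t_0^{\pm1},\dots,t_n^{\pm1}]$ and $t^{\underline k}=t_0^{k_0}\cdots t_n^{k_n}$ for $\underline k\in\mathbb{Z}^{n+1}$. Let $\Omega_A$ be the free $A$-module with basis $K_0,\dots,K_n$, $d:A\to\Omega_A$ the linear map $d(t^{\underline k})=\sum_i k_i t^{\underline k}K_i$, and $\mathcal{Z}=\Omega_A/dA$; the image of $t^{\underline k}K_i$ in $\mathcal Z$ is again denoted $t^{\underline k}K_i$. Let $d_i=t_i\partial/\partial t_i$ and $\mathcal{W}_{n+1}=\mathrm{span}\{t^{\underline r}d_i\}=\mathrm{Der}(A)$. Put $\phi_1(t^{\underline r}d_i,t^{\underline s}d_j)=-s_ir_j\sum_p r_pt^{\underline r+\underline s}K_p$, $\phi_2(t^{\underline r}d_i,t^{\underline s}d_j)=r_is_j\sum_p r_pt^{\underline r+\underline s}K_p$, and let $\phi$ be an arbitrary fixed linear combination of $\phi_1,\phi_2$. The full toroidal Lie algebra is $\tau=(\mathfrak g\otimes A)\oplus\mathcal Z\oplus\mathcal W_{n+1}$ with brackets: $[x\otimes t^{\underline k},y\otimes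 t^{\underline l}]=[x,y]\otimes t^{\underline k+\underline l}+(x|y)\sum_i k_it^{\underline k+\underline l}K_i$; $\mathcal Z$ is abelian and commutes with $\mathfrak g\otimes A$; $[t^{\underline r}d_i,t^{\underline s}K_j]=s_it^{\underline r+\underline s}K_j+\delta_{ij}\sum_p r_pt^{\underline r+\underline s}K_p$; $[t^{\underline r}d_i,t^{\underline s}d_j]=s_it^{\underline r+\underline s}d_j-r_jt^{\underline r+\underline s}d_i+\phi(t^{\underline r}d_i,t^{\underline s}d_j)$; $[t^{\underline r}d_i,x\otimes t^{\underline s}]=s_i\,x\otimes t^{\underline r+\underline s}$. It is $\mathbb{Z}^{n+1}$-graded, $\tau_{\underline m}=\mathrm{span}\{x\otimes t^{\underline m},t^{\underline m}K_i,t^{\underline m}d_i\}$. Let $D=\mathrm{span}\{d_0,\dots,d_n\}$; $\underline m\in\mathbb{Z}^{n+1}$ is identified with the functional $d_i\mapsto m_i$ in $D^*$. For a $\tau$-module $V$ and $\mu\in D^*$ put $V_\mu=\{v:d_iv=\mu(d_i)v\ \forall i\}$. $V$ is a Harish-Chandra module if, for some $\lambda\in D^*$, $V=\bigoplus_{\underline m\in\mathbb{Z}^{n+1}}V_{\lambda+\underline m}$ with all $V_{\lambda+\underline m}$ finite-dimensional; it is cuspidal if moreover the dimensions of the weight spaces are uniformly bounded. Non-trivial means that $\tau$ does not act by zero. A $\tau$-module $V$ is a GHW module with GHW $\Lambda_0\in D^*$ if there exist a non-zero $v_{\Lambda_0}\in V_{\Lambda_0}$ and $p\in\mathbb N$ with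 $\tau_{\underline k}v_{\Lambda_0}=(0)$ for all $\underline k\in\mathbb{Z}^{n+1}$ with $k_i\geqslant p$ for all $0\le i\le n$. For $B=(a_{ij})_{0\le i,j\le n}\in GL(n+1,\mathbb{Z})$ with inverse $(b_{ij})$, the automorphism $T_B$ of $\tau$ is $T_B(x\otimes t^{\underline m})=x\otimes t^{\underline mB^t}$, $T_B(t^{\underline m}K_j)=\sum_p a_{pj}t^{\underline mB^t}K_p$, $T_B(t^{\underline m}d_j)=\sum_p b_{jp}t^{\underline mB^t}d_p$ ($\underline m$ a row vector). ''Up to a change of co-ordinates'' means: after twisting the $\tau$-action on $V$ by some $T_B$, $B\in GL(n+1,\mathbb{Z})$. *)

(* Defs.v *)
From HB Require Import structures.
From mathcomp Require Import all_boot all_order all_algebra.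
From mathcomp Require Import finmap.
From mathcomp Require Import all_classical all_reals.
From mathcomp Require Import complex ring.
Set Implicit Arguments. Unset Strict Implicit. Unset Printing Implicit Defensive.
Import Order.TTheory GRing.Theory Num.Theory.
Local Open Scope quotient_scope.
Local Open Scope classical_set_scope.
Local Open Scope ring_scope.

(* The constructions are made over any numFieldType K; the theorem takes
   K := R[i] with R : realType. *)

HB.mixin Record isLieAlgebra (K : pzRingType) L of GRing.Lmodule K L := {
  lie : L -> L -> L;
  lieDl : forall a x y z, lie (a *: x + y) z = a *: lie x z + lie y z;
  lieDr : forall a x y z, lie z (a *: x + y) = a *: lie z x + lie z y;
  liexx : forall x, lie x x = 0;
  lie_jacobi : forall x y z,
    lie x (lie y z) + lie y (lie z x) + lie z (lie x y) = 0
}.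

#[short(type="lieAlgType")]
HB.structure Definition LieAlgebra (K : pzRingType) :=
  {L of isLieAlgebra K L & GRing.Lmodule K L}.

#[short(type="fdLieAlgType")]
HB.structure Definition FdLieAlgebra (K : nzRingType) :=
  {L of isLieAlgebra K L & Vector K L}.

Definition simple_lie (K : fieldType) (g : fdLieAlgType K) : Prop :=
  (exists x y : g, lie x y <> 0) /\
  forall I : {vspace g},
    (forall x y, y \in I -> lie x y \in I) -> I = 0%VS \/ I = fullv.

Record invForm (K : pzRingType) (g : lieAlgType K) := InvForm {
  inv_form :> g -> g -> K;
  inv_formDl : forall a x y z,
    inv_form (a *: x + y) z = a * inv_form x z + inv_form y z;
  inv_formC : forall x y, inv_form x y = inv_form y x;
  inv_formA : forall x y z, inv_form (lie x y) z = inv_form x (lie y z);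
  inv_form_nondeg : forall x, (forall y, inv_form x y = 0) -> x = 0
}.

Section LieTheory.
Variables (K : pzRingType) (L : lieAlgType K).
Implicit Types x y z : L.

Lemma lie_addl x y z : lie (x + y) z = lie x z + lie y z.
Proof. by have := lieDl 1 x y z; rewrite !scale1r. Qed.
Lemma lie_addr x y z : lie z (x + y) = lie z x + lie z y.
Proof. by have := lieDr 1 x y z; rewrite !scale1r. Qed.
Lemma lie0l z : lie 0 z = 0 :> L.
Proof. by have /eqP := lie_addl 0 0 z; rewrite addr0 -subr_eq0 opprD addNKr oppr_eq0 => /eqP. Qed.
Lemma lie0r z : lie z 0 = 0 :> L.
Proof. by have /eqP := lie_addr 0 0 z; rewrite addr0 -subr_eq0 opprD addNKr oppr_eq0 => /eqP. Qed.
Lemma lie_scalel a x z : lie (a *: x) z = a *: lie x z.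
Proof. by have := lieDl a x 0 z; rewrite lie0l !addr0. Qed.
Lemma lie_scaler a x z : lie z (a *: x) = a *: lie z x.
Proof. by have := lieDr a x 0 z; rewrite lie0r !addr0. Qed.
Lemma lieC x y : lie x y = - lie y x.
Proof.
apply/eqP; rewrite -addr_eq0; apply/eqP.
by have := liexx (x + y); rewrite lie_addl !lie_addr !liexx add0r addr0.
Qed.

End LieTheory.

Notation expo n := 'rV[int]_n.+1.

(* Laurent polynomials in t_0, ..., t_n with coefficients in E, i.e. E (x) A,
   as finitely supported families of coefficients; A itself is laurent n K^o. *)
Section Laurent.
Variables (K : pzRingType) (n : nat) (E : lmodType K).

Definition fin_supp : {pred expo n -> E} :=
  fun f => `[< finite_set [set k | f k <> 0] >].

Lemma fin_suppP f : reflect (finite_set [set k | f k <> 0]) (f \in fin_supp).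
Proof. exact: asboolP. Qed.

Lemma fin_supp_submod : submod_closed fin_supp.
Proof.
split=> [|a f h /fin_suppP ff /fin_suppP fh].
  by apply/fin_suppP/(@sub_finite_set _ _ set0).
apply/fin_suppP.
apply: (@sub_finite_set _ _ ([set k | f k <> 0] `|` [set k | h k <> 0])).
  move=> k /=; have -> : (a *: f + h) k = a *: f k + h k by [].
  case: (pselect (f k = 0)) => [->|]; last by left.
  by rewrite scaler0 add0r; right.
by rewrite finite_setU.
Qed.
HB.instance Definition _ := GRing.isSubmodClosed.Build K (expo n -> E) fin_supp
  fin_supp_submod.

Record laurent := Laurent { lcoef :> expo n -> E; _ : lcoef \in fin_supp }.
HB.instance Definition _ := [isSub for lcoef].
HB.instance Definition _ := [Choice of laurent by <:].
HB.instance Definition _ := [SubChoice_isSubLmodule of laurent by <:].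

Lemma mono_subproof k (x : E) : (fun j => if j == k then x else 0) \in fin_supp.
Proof.
apply/fin_suppP/(@sub_finite_set _ _ [set k]) => //= j /=.
by case: eqP.
Qed.
(* x t^k *)
Definition mono k (x : E) : laurent := Laurent (mono_subproof k x).

Lemma laurentP (f h : laurent) : (forall k, f k = h k) <-> f = h.
Proof. by split=> [fh|-> //]; apply/val_inj/funext. Qed.

End Laurent.

(* \sum_k F k (f k): the extension to E (x) A of the map x t^k |-> F k x. *)
Section Extension.
Variables (K : pzRingType) (n : nat) (E V : lmodType K).
Implicit Types (F : expo n -> E -> V).

Definition lext F (f : laurent n E) : V := \sum_(k \in [set: expo n]) F k (f k).

Lemma lextE F (f : laurent n E) (A : {fset expo n}) :
  (forall k, F k 0 = 0) -> (forall k, k \notin A -> f k = 0) ->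
  lext F f = \sum_(k <- A) F k (f k).
Proof. by move=> F0 fA; apply: fsbigTE => k /fA ->. Qed.

Lemma supp_exists (f : laurent n E) :
  exists A : {fset expo n}, forall k, k \notin A -> f k = 0.
Proof.
case: f => f /= /fin_suppP ff; exists (fset_set [set k | f k <> 0]) => k.
by rewrite in_fset_set // notin_setE /= => /contrapT.
Qed.

Lemma lext_lin F : (forall k, linear (F k)) -> linear (lext F).
Proof.
move=> lF a f h; have F0 k : F k 0 = 0.
  by have := lF k (-1) 0 0; rewrite scaler0 addr0 scaleN1r addNr.
have [A fA] := supp_exists f; have [B hB] := supp_exists h.
pose C := (A `|` B)%fset.
have fC k : k \notin C -> f k = 0 by rewrite inE negb_or => /andP[/fA].
have hC k : k \notin C -> h k = 0 by rewrite inE negb_or => /andP[_ /hB].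
have fh k : (a *: f + h : laurent n E) k = a *: f k + h k by [].
rewrite !(@lextE _ _ C) // => [|k kC].
  by rewrite scaler_sumr -big_split; apply: eq_bigr => k _; rewrite fh lF.
by rewrite fh fC // hC // scaler0 addr0.
Qed.

Lemma lext_mono F k x : (forall k, F k 0 = 0) -> lext F (mono k x) = F k x.
Proof.
move=> F0; rewrite (@lextE _ _ [fset k]%fset) // => [|j].
  by rewrite big_seq_fset1 /= eqxx.
by rewrite inE /=; case: eqP.
Qed.

Lemma lext_eq F G f : (forall k x, F k x = G k x) -> lext F f = lext G f.
Proof. by move=> FG; apply: eq_fsbigr => k _. Qed.

Lemma lext_lincomb a F G f : (forall k, F k 0 = 0) -> (forall k, G k 0 = 0) ->
  lext (fun k x => a *: F k x + G k x) f = a *: lext F f + lext G f.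
Proof.
move=> F0 G0; have [A fA] := supp_exists f; rewrite !(@lextE _ _ A) //.
  by rewrite scaler_sumr -big_split.
by move=> k; rewrite F0 G0 scaler0 addr0.
Qed.

End Extension.

Lemma mono_lin (K : pzRingType) n (E : lmodType K) (k : expo n) :
  linear (@mono K n E k).
Proof.
move=> a x y; apply/laurentP => j /=.
rewrite -[RHS]/(a *: mono k x j + mono k y j) /=.
by case: eqP => // _; rewrite scaler0 addr0.
Qed.
HB.instance Definition _ (K : pzRingType) n (E : lmodType K) (k : expo n) :=
  GRing.isLinear.Build K E (laurent n E) *:%R (@mono K n E k) (@mono_lin K n E k).

Lemma laurent_decomp (K : pzRingType) n (E : lmodType K) (f : laurent n E)
  (A : {fset expo n}) : (forall k, k \notin A -> f k = 0) ->
  f = \sum_(k <- A) mono k (f k).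
Proof.
move=> fA; apply/laurentP => j.
have valsum (s : seq (expo n)) :
  lcoef (\sum_(k <- s) mono k (f k)) j = \sum_(k <- s) lcoef (mono k (f k)) j.
  by elim/big_rec2: _ => [|k y z _ <-].
rewrite valsum /=; case: (boolP (j \in A)) => jA.
  rewrite (big_fsetD1 j) //= eqxx big_seq big1 ?addr0 // => k.
  by rewrite !inE eq_sym => /andP[/negPf ->].
rewrite fA // big_seq big1 // => k kA; case: eqP => // jk.
by rewrite jk kA in jA.
Qed.

Section Differentials.
Variables (K : numFieldType) (n : nat).
Local Notation rV := 'rV[K]_n.+1.

Definition kvec (k : expo n) : rV := map_mx intr k.
Definition dot (u v : rV) : K := \sum_i u 0 i * v 0 i.

Lemma kvecD k l : kvec (k + l) = kvec k + kvec l.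
Proof. by apply/rowP => i; rewrite !mxE intrD. Qed.
Lemma dotDl a u v w : dot (a *: u + v) w = a * dot u w + dot v w.
Proof.
rewrite /dot mulr_sumr -big_split; apply: eq_bigr => i _.
by rewrite !mxE mulrDl mulrA.
Qed.
Lemma dotC u v : dot u v = dot v u.
Proof. by apply: eq_bigr => i _; rewrite mulrC. Qed.
Lemma dotDr a u v w : dot w (a *: u + v) = a * dot w u + dot w v.
Proof. by rewrite dotC dotDl !(dotC w). Qed.
Lemma dot_addl u v w : dot (u + v) w = dot u w + dot v w.
Proof. by have := dotDl 1 u v w; rewrite scale1r mul1r. Qed.
Lemma dot_addr u v w : dot w (u + v) = dot w u + dot w v.
Proof. by have := dotDr 1 u v w; rewrite scale1r mul1r. Qed.
Lemma dot0l w : dot 0 w = 0.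
Proof. by rewrite /dot big1 // => i _; rewrite mxE mul0r. Qed.
Lemma dot0r w : dot w 0 = 0. Proof. by rewrite dotC dot0l. Qed.
Lemma dot_scalel a u w : dot (a *: u) w = a * dot u w.
Proof. by have := dotDl a u 0 w; rewrite dot0l !addr0. Qed.
Lemma dot_scaler a u w : dot w (a *: u) = a * dot w u.
Proof. by rewrite dotC dot_scalel dotC. Qed.

(* The free A-module on K_0, ..., K_n: v t^k stands for \sum_i v_i t^k K_i. *)
Definition Omega := laurent n rV.
HB.instance Definition _ := GRing.Lmodule.on Omega.

Definition dOmega (a : laurent n K^o) : Omega :=
  lext (fun k (c : K^o) => mono k ((c : K) *: kvec k)) a.

Lemma dOmega_lin : linear dOmega.
Proof.
by apply: lext_lin => k a x y; rewrite -linearP scalerA -scalerDl.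
Qed.
HB.instance Definition _ :=
  GRing.isLinear.Build K (laurent n K^o) Omega *:%R dOmega dOmega_lin.

Definition dA : {pred Omega} := fun w => `[< exists a, w = dOmega a >].

Lemma dA_submod : submod_closed dA.
Proof.
split=> [|a x y /asboolP[b ->] /asboolP[c ->]]; apply/asboolP.
  by exists 0; rewrite linear0.
by exists (a *: b + c); rewrite linearP.
Qed.
HB.instance Definition _ := GRing.isSubmodClosed.Build K Omega dA dA_submod.

Lemma dA_mono k (c : K) : mono k (c *: kvec k) \in dA.
Proof.
apply/asboolP; exists (mono k (c : K^o)); rewrite /dOmega lext_mono // => j.
by rewrite scale0r linear0.
Qed.

(* Z = Omega_A / dA *)
Definition centerZ := Quotient.quot dA.
HB.instance Definition _ := GRing.Zmodule.on centerZ.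
Definition toZ : Omega -> centerZ := \pi_centerZ.

Lemma toZ_eq x y : (toZ x = toZ y) <-> (x - y \in dA).
Proof. by rewrite Quotient.idealrBE; split=> /eqP. Qed.
Lemma toZK z : toZ (repr z) = z. Proof. exact: reprK. Qed.
Lemma toZD x y : toZ (x + y) = toZ x + toZ y.
Proof. exact: (raddfD \pi_(Quotient.quot dA)). Qed.

Definition scaleZ (a : K) (z : centerZ) : centerZ := toZ (a *: repr z).
Lemma scaleZE a x : scaleZ a (toZ x) = toZ (a *: x).
Proof.
by apply/toZ_eq; rewrite -scalerBr rpredZ //; apply/toZ_eq; rewrite toZK.
Qed.
Lemma scaleZA a b z : scaleZ a (scaleZ b z) = scaleZ (a * b) z.
Proof. by rewrite -[z]toZK !scaleZE scalerA. Qed.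
Lemma scaleZ1 : left_id 1 scaleZ.
Proof. by move=> z; rewrite -[z]toZK scaleZE scale1r. Qed.
Lemma scaleZDr : right_distributive scaleZ +%R.
Proof.
move=> a y z; rewrite -[y]toZK -[z]toZK.
by rewrite -toZD !scaleZE -toZD scalerDr.
Qed.
Lemma scaleZDl z : {morph scaleZ^~ z : a b / a + b}.
Proof. by move=> a b; rewrite -[z]toZK !scaleZE -toZD scalerDl. Qed.
HB.instance Definition _ := GRing.Zmodule_isLmodule.Build K centerZ
  scaleZA scaleZ1 scaleZDr scaleZDl.

Lemma toZ_lin : linear toZ.
Proof. by move=> a x y; rewrite toZD -scaleZE. Qed.
HB.instance Definition _ :=
  GRing.isLinear.Build K Omega centerZ *:%R toZ toZ_lin.

End Differentials.

Section BilinearExtension.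
Variables (K : pzRingType) (n : nat) (E1 E2 V : lmodType K).
Implicit Types (F : expo n -> E1 -> expo n -> E2 -> V).

Definition lext2 F (f : laurent n E1) (h : laurent n E2) : V :=
  lext (fun k x => lext (F k x) h) f.

Lemma lext2P F : (forall k l y, linear (F k ^~ l ^~ y)) ->
  (forall k x l, linear (F k x l)) ->
  (forall h, linear (lext2 F ^~ h)) * (forall f, linear (lext2 F f)) *
  (forall k x l y, lext2 F (mono k x) (mono l y) = F k x l y).
Proof.
move=> Fl Fr; have Fl0 k l y : F k 0 l y = 0.
  by have := Fl k l y (-1) 0 0; rewrite scaler0 addr0 scaleN1r addNr.
have Fr0 k x l : F k x l 0 = 0.
  by have := Fr k x l (-1) 0 0; rewrite scaler0 addr0 scaleN1r addNr.
have F0 k h : lext (F k 0) h = 0 by apply: fsbig1 => l _; apply: Fl0.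
split; [split=> [h|f a h1 h2]|move=> k x l y].
- apply: lext_lin => k a x y; rewrite -lext_lincomb //.
  by apply: lext_eq => l z; apply: Fl.
- rewrite /lext2 -lext_lincomb //; apply: lext_eq => k x.
  by rewrite lext_lin.
- by rewrite /lext2 !lext_mono.
Qed.

End BilinearExtension.

Section Brackets.
Variables (K : numFieldType) (n : nat) (g : lieAlgType K) (form : invForm g).
Local Notation rV := 'rV[K]_n.+1.
Local Notation kv := (@kvec K n).

(* In laurent n rV seen as W_(n+1), u t^r stands for \sum_i u_i t^r d_i, so
   that, for s an exponent, dot u s is the eigenvalue of \sum_i u_i d_i on t^s. *)

Definition brgg : laurent n g -> laurent n g -> laurent n g :=
  lext2 (fun k x l y => mono (k + l) (lie x y)).

Definition brggZ : laurent n g -> laurent n g -> centerZ K n :=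
  lext2 (fun k x l y => toZ (mono (k + l) (form x y *: kv k))).

Definition brWg : laurent n rV -> laurent n g -> laurent n g :=
  lext2 (fun r u s x => mono (r + s) (dot u (kv s) *: x)).

Definition brWOmega : laurent n rV -> Omega K n -> Omega K n :=
  lext2 (fun r u s v => mono (r + s) (dot u (kv s) *: v + dot u v *: kv r)).

Definition brWZ (w : laurent n rV) (z : centerZ K n) : centerZ K n :=
  toZ (brWOmega w (repr z)).

Definition brWW : laurent n rV -> laurent n rV -> laurent n rV :=
  lext2 (fun r u s v =>
    mono (r + s) (dot u (kv s) *: v - dot v (kv r) *: u)).

Definition phi1 : laurent n rV -> laurent n rV -> centerZ K n :=
  lext2 (fun r u s v =>
    toZ (mono (r + s) (- (dot u (kv s) * dot v (kv r)) *: kv r))).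

Definition phi2 : laurent n rV -> laurent n rV -> centerZ K n :=
  lext2 (fun r u s v =>
    toZ (mono (r + s) ((dot u (kv r) * dot v (kv s)) *: kv r))).

Lemma brggP : (forall h, linear (brgg ^~ h)) * (forall f, linear (brgg f)) *
  (forall k x l y, brgg (mono k x) (mono l y) = mono (k + l) (lie x y)).
Proof.
by apply: lext2P => [k l y a x z|k x l a y z]; rewrite -linearP (lieDl, lieDr).
Qed.

Lemma brggZP : (forall h, linear (brggZ ^~ h)) * (forall f, linear (brggZ f)) *
  (forall k x l y,
    brggZ (mono k x) (mono l y) = toZ (mono (k + l) (form x y *: kv k))).
Proof.
apply: lext2P => [k l y a x z|k x l a y z]; rewrite -!linearP scalerA -scalerDl.
  by rewrite inv_formDl.
by rewrite inv_formC inv_formDl !(inv_formC _ x).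
Qed.

Lemma brWgP : (forall h, linear (brWg ^~ h)) * (forall f, linear (brWg f)) *
  (forall r u s x,
    brWg (mono r u) (mono s x) = mono (r + s) (dot u (kv s) *: x)).
Proof.
apply: lext2P => [r s x a u v|r u s a x y]; rewrite -linearP.
  by rewrite scalerA -scalerDl dotDl.
by rewrite scalerDr !scalerA mulrC.
Qed.

Lemma brWOmegaP :
  (forall h, linear (brWOmega ^~ h)) * (forall f, linear (brWOmega f)) *
  (forall r u s v, brWOmega (mono r u) (mono s v) =
    mono (r + s) (dot u (kv s) *: v + dot u v *: kv r)).
Proof.
apply: lext2P => [r s x a u v|r u s a x y]; rewrite -linearP; congr mono;
by apply/rowP => i; rewrite !(dotDl, dotDr) !mxE; ring.
Qed.

Lemma brWWP : (forall h, linear (brWW ^~ h)) * (forall f, linear (brWW f)) *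
  (forall r u s v, brWW (mono r u) (mono s v) =
    mono (r + s) (dot u (kv s) *: v - dot v (kv r) *: u)).
Proof.
apply: lext2P => [r s x a u v|r u s a x y]; rewrite -linearP; congr mono;
by apply/rowP => i; rewrite !(dotDl, dotDr) !mxE; ring.
Qed.

Lemma phi1P : (forall h, linear (phi1 ^~ h)) * (forall f, linear (phi1 f)) *
  (forall r u s v, phi1 (mono r u) (mono s v) =
    toZ (mono (r + s) (- (dot u (kv s) * dot v (kv r)) *: kv r))).
Proof.
apply: lext2P => [r s x a u v|r u s a x y]; rewrite -!linearP; congr (toZ (mono _ _));
by apply/rowP => i; rewrite !(dotDl, dotDr) !mxE; ring.
Qed.

Lemma phi2P : (forall h, linear (phi2 ^~ h)) * (forall f, linear (phi2 f)) *
  (forall r u s v, phi2 (mono r u) (mono s v) =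
    toZ (mono (r + s) ((dot u (kv r) * dot v (kv s)) *: kv r))).
Proof.
apply: lext2P => [r s x a u v|r u s a x y]; rewrite -!linearP; congr (toZ (mono _ _));
by apply/rowP => i; rewrite !(dotDl, dotDr) !mxE; ring.
Qed.

Lemma brWOmega_dA w x : x \in @dA K n -> brWOmega w x \in @dA K n.
Proof.
move=> /asboolP[a ->]; have [A wA] := supp_exists w; have [B aB] := supp_exists a.
have lin0 (U V : lmodType K) (h : U -> V) : linear h -> h 0 = 0.
  by move=> hl; have := hl (-1) 0 0; rewrite scaler0 addr0 scaleN1r addNr.
have linD (U V : lmodType K) (h : U -> V) : linear h -> {morph h : y z / y + z}.
  by move=> hl y z; have := hl 1 y z; rewrite !scale1r.
rewrite (laurent_decomp wA).
rewrite (big_morph (brWOmega ^~ _) (linD _ _ _ (brWOmegaP.1.1 _)) (lin0 _ _ _ (brWOmegaP.1.1 _))).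
rewrite rpred_sum // => r _; rewrite (laurent_decomp aB) linear_sum.
rewrite (big_morph (brWOmega _) (linD _ _ _ (brWOmegaP.1.2 _)) (lin0 _ _ _ (brWOmegaP.1.2 _))).
rewrite rpred_sum // => s _.
rewrite /= /dOmega lext_mono; last by move=> j; rewrite scale0r linear0.
rewrite brWOmegaP.2; set c := a s; set u := w r.
have -> : dot u (kv s) *: (c *: kv s) + dot u (c *: kv s) *: kv r =
   (dot u (kv s) * c) *: kv (r + s).
  by apply/rowP => i; rewrite dot_scaler kvecD !mxE; ring.
exact: dA_mono.
Qed.

Lemma brWZE w x : brWZ w (toZ x) = toZ (brWOmega w x).
Proof.
apply/toZ_eq; rewrite -scaleN1r addrC -brWOmegaP.1.2 brWOmega_dA // addrC scaleN1r.
by apply/toZ_eq; rewrite toZK.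
Qed.

Lemma brWZP : (forall z, linear (brWZ ^~ z)) * (forall w, linear (brWZ w)).
Proof.
split=> [z a x y|w a x y]; rewrite /brWZ.
  by rewrite brWOmegaP.1.1 linearP.
by rewrite -[x]toZK -[y]toZK -linearP -!/(brWZ _ _) !brWZE brWOmegaP.1.2 linearP.
Qed.

End Brackets.

(* The given vectors are images of indeterminates under a linear map, so that
   an identity of linear combinations can be checked on coordinates. *)
Lemma lin_indet (K : pzRingType) (V : lmodType K) (xs : seq V) :
  exists M : 'rV[K]_(size xs) -> V,
  [/\ forall i, xs`_(val i) = M (delta_mx 0 i), M 0 = 0,
      forall u v, M u + M v = M (u + v), forall u, - M u = M (- u) &
      forall a u, a *: M u = M (a *: u)].
Proof.
exists (fun c : 'rV[K]_(size xs) => \sum_i c 0 i *: xs`_i); split=> [i||u v|u|a u].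
- rewrite (bigD1 i) //= big1 ?addr0 => [|j jni].
    by rewrite mxE !eqxx scale1r.
  by rewrite mxE (negPf jni) andbF scale0r.
- by rewrite big1 // => i _; rewrite mxE scale0r.
- by rewrite -big_split; apply: eq_bigr => i _; rewrite mxE scalerDl.
- by rewrite -sumrN; apply: eq_bigr => i _; rewrite mxE scaleNr.
- by rewrite scaler_sumr; apply: eq_bigr => i _; rewrite mxE scalerA.
Qed.
(* The full toroidal Lie algebra, with phi = c1 phi_1 + c2 phi_2. *)
Definition tau (K : numFieldType) n (g : lieAlgType K) of invForm g & K & K :
    Type :=
  (laurent n g * centerZ K n * laurent n 'rV[K]_n.+1)%type.
HB.instance Definition _ (K : numFieldType) n (g : lieAlgType K)
  (form : invForm g) (c1 c2 : K) := GRing.Lmodule.on (tau n form c1 c2).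

Section Toroidal.
Variables (K : numFieldType) (n : nat) (g : lieAlgType K) (form : invForm g).
Variables (c1 c2 : K).
Local Notation rV := 'rV[K]_n.+1.
Local Notation kv := (@kvec K n).
Local Notation tau := (tau n form c1 c2).

Definition tau_lie (a b : tau) : tau :=
  let: (f, z, w) := a in let: (f', z', w') := b in
  (brgg f f' + brWg w f' - brWg w' f,
   brggZ form f f' + brWZ w z' - brWZ w' z + (c1 *: phi1 w w' + c2 *: phi2 w w'),
   brWW w w').

(* x (x) t^k + \sum_i v_i t^k K_i + \sum_i u_i t^k d_i *)
Definition homog (k : expo n) (x : g) (v u : rV) : tau :=
  (mono k x, toZ (mono k v), mono k u).

Lemma homogD k x v u x' v' u' :
  homog k x v u + homog k x' v' u' = homog k (x + x') (v + v') (u + u').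
Proof. by rewrite /homog !raddfD. Qed.
Lemma homogN k x v u : - homog k x v u = homog k (- x) (- v) (- u).
Proof. by rewrite /homog !raddfN. Qed.
Lemma homogZ a k x v u : a *: homog k x v u = homog k (a *: x) (a *: v) (a *: u).
Proof. by rewrite /homog !linearZ. Qed.
Lemma homog0 k v c : v = c *: kv k -> homog k 0 v 0 = 0.
Proof.
move=> ->; rewrite /homog !linear0.
have -> : toZ (mono k (c *: kv k)) = 0; last by [].
by rewrite -[RHS](linear0 (@toZ K n)); apply/toZ_eq; rewrite subr0 dA_mono.
Qed.

Lemma tau_ind (P : tau -> Prop) :
  P 0 -> (forall a b, P a -> P b -> P (a + b)) ->
  (forall k x v u, P (homog k x v u)) -> forall a, P a.
Proof.
move=> P0 PD Ph [[f z] w].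
have Psum (A : {fset expo n}) F : (forall k, P (F k)) -> P (\sum_(k <- A) F k).
  by move=> PF; elim/big_ind: _.
have pairD (a a' : laurent n g) (b b' : centerZ K n) (c c' : laurent n rV) :
  ((a, b, c) : tau) + (a', b', c') = (a + a', b + b', c + c') by [].
have -> : ((f, z, w) : tau) = (f, 0, 0) + (0, z, 0) + (0, 0, w).
  by rewrite !pairD !addr0 !add0r.
apply: (PD); first apply: (PD).
- have [A fA] := supp_exists f.
  have -> : ((f, 0, 0) : tau) = \sum_(k <- A) homog k (f k) 0 0.
    rewrite {1}(laurent_decomp fA).
    elim/big_rec2: _ => // k a b _ <-.
    by rewrite /homog !linear0 pairD !addr0.
  exact: Psum.
- rewrite -[z]toZK; have [A fA] := supp_exists (repr z).
  have -> : ((0, toZ (repr z), 0) : tau) =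
      \sum_(k <- A) homog k 0 (lcoef (repr z) k) 0.
    rewrite {1}(laurent_decomp fA) linear_sum.
    elim/big_rec2: _ => // k a b _ <-.
    by rewrite /homog !linear0 pairD !addr0.
  exact: Psum.
- have [A fA] := supp_exists w.
  have -> : ((0, 0, w) : tau) = \sum_(k <- A) homog k 0 0 (w k).
    rewrite {1}(laurent_decomp fA).
    elim/big_rec2: _ => // k a b _ <-.
    by rewrite /homog !linear0 pairD !addr0.
  exact: Psum.
Qed.

Lemma lin_comb (V : lmodType K) a (A1 A2 B1 B2 : V) c :
  ((a *: A1 + A2) + (a *: B1 + B2) = a *: (A1 + B1) + (A2 + B2)) *
  ((a *: A1 + A2) - (a *: B1 + B2) = a *: (A1 - B1) + (A2 - B2)) *
  (c *: (a *: A1 + A2) = a *: (c *: A1) + c *: A2).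
Proof.
split; first split.
- by rewrite scalerDr addrACA.
- by rewrite opprD scalerBr addrACA.
- by rewrite scalerDr !scalerA mulrC.
Qed.

Lemma tau_lieDl a x y z : tau_lie (a *: x + y) z = a *: tau_lie x z + tau_lie y z.
Proof.
case: x y z => [[x1 x2] x3] [[y1 y2] y3] [[z1 z2] z3].
have [[bg _] _] := brggP n g; have [[bZ _] _] := brggZP n form.
have [[bw bw'] _] := brWgP n g; have [bz bz'] := brWZP K n.
have [[bW _] _] := brWWP K n.
have [[p1 _] _] := phi1P K n; have [[p2 _] _] := phi2P K n.
rewrite -[X in tau_lie X]/((a *: x1 + y1, a *: x2 + y2, a *: x3 + y3) : tau).
rewrite /tau_lie bg bZ bw bw' bz bz' bW p1 p2.
by rewrite !lin_comb.
Qed.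

Lemma tau_lieDr a x y z : tau_lie z (a *: x + y) = a *: tau_lie z x + tau_lie z y.
Proof.
case: x y z => [[x1 x2] x3] [[y1 y2] y3] [[z1 z2] z3].
have [[_ bg] _] := brggP n g; have [[_ bZ] _] := brggZP n form.
have [[bw bw'] _] := brWgP n g; have [bz bz'] := brWZP K n.
have [[_ bW] _] := brWWP K n.
have [[_ p1] _] := phi1P K n; have [[_ p2] _] := phi2P K n.
rewrite -[X in tau_lie _ X]/((a *: x1 + y1, a *: x2 + y2, a *: x3 + y3) : tau).
rewrite /tau_lie bg bZ bw bw' bz bz' bW p1 p2.
by rewrite !lin_comb.
Qed.

Lemma tau_lie_homog r x v u s y w z :
  tau_lie (homog r x v u) (homog s y w z) =
  homog (r + s)
    (lie x y + dot u (kv s) *: y - dot z (kv r) *: x)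
    (form x y *: kv r + (dot u (kv s) *: w + dot u w *: kv r)
     - (dot z (kv r) *: v + dot z v *: kv s)
     + (c1 *: (- (dot u (kv s) * dot z (kv r)) *: kv r)
        + c2 *: ((dot u (kv r) * dot z (kv s)) *: kv r)))
    (dot u (kv s) *: z - dot z (kv r) *: u).
Proof.
rewrite /tau_lie /homog !brWZE.
rewrite (brggP n g).2 (brggZP n form).2 !(brWgP n g).2 !(brWOmegaP K n).2.
rewrite (brWWP K n).2 (phi1P K n).2 (phi2P K n).2 (addrC s r).
by rewrite -!linearZ -!linearD -!linearN -!linearD.
Qed.

End Toroidal.

Section ToroidalLie.
Variables (K : numFieldType) (n : nat) (g : lieAlgType K) (form : invForm g).
Variables (c1 c2 : K).
Local Notation rV := 'rV[K]_n.+1.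
Local Notation kv := (@kvec K n).
Local Notation tau := (tau n form c1 c2).

Local Notation tau_lie := (@tau_lie K n g form c1 c2).
Local Notation homog := (@homog K n g form c1 c2).

Lemma tau_lie0l z : tau_lie 0 z = 0.
Proof. by have := tau_lieDl (-1) 0 0 z; rewrite scaler0 addr0 scaleN1r addNr. Qed.
Lemma tau_lie0r z : tau_lie z 0 = 0.
Proof. by have := tau_lieDr (-1) 0 0 z; rewrite scaler0 addr0 scaleN1r addNr. Qed.
Lemma tau_lie_addl x y z : tau_lie (x + y) z = tau_lie x z + tau_lie y z.
Proof. by have := tau_lieDl 1 x y z; rewrite !scale1r. Qed.
Lemma tau_lie_addr x y z : tau_lie z (x + y) = tau_lie z x + tau_lie z y.
Proof. by have := tau_lieDr 1 x y z; rewrite !scale1r. Qed.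

Lemma tau_lieC a b : tau_lie a b + tau_lie b a = 0.
Proof.
elim/tau_ind: a => [|a a' Ha Ha'|r x v u].
- by rewrite tau_lie0l tau_lie0r addr0.
- by rewrite tau_lie_addl tau_lie_addr addrACA Ha Ha' addr0.
elim/tau_ind: b => [|b b' Hb Hb'|s y w z].
- by rewrite tau_lie0l tau_lie0r addr0.
- by rewrite tau_lie_addl tau_lie_addr addrACA Hb Hb' addr0.
rewrite !tau_lie_homog (addrC s r) homogD.
set X := (X in homog _ X); set U := (U in homog _ _ _ U).
have -> : X = 0.
  rewrite /X (lieC y x); move: (lie x y) => t.
  have [M [ME M0 MD MN MZ]] := lin_indet [:: x; y; t].
  have /= Ex := ME (@Ordinal 3 0 isT); have /= Ey := ME (@Ordinal 3 1 isT).
  have /= Et := ME (@Ordinal 3 2 isT); rewrite {}Ex {}Ey {}Et.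
  rewrite !(MZ, MN, MD) -[RHS]M0; congr M.
  by apply/rowP => i; rewrite !mxE; ring.
have -> : U = 0 by apply/rowP => i; rewrite !mxE; ring.
apply: (@homog0 K n g form c1 c2 _ _ (form x y - c1 * (dot u (kv s) * dot z (kv r))
  + c2 * (dot u (kv r) * dot z (kv s)))).
apply/rowP => i; rewrite (inv_formC form y x) kvecD !mxE.
ring.
Qed.

Lemma tau_liexx a : tau_lie a a = 0.
Proof.
have /eqP := tau_lieC a a; rewrite -mulr2n -scaler_nat scaler_eq0.
by rewrite pnatr_eq0 /= => /eqP.
Qed.

Lemma tau_lie_jacobi a b c :
  tau_lie a (tau_lie b c) + tau_lie b (tau_lie c a) + tau_lie c (tau_lie a b) = 0.
Proof.
have addr6 (A B C D E F : tau) :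
  A + B + (C + D) + (E + F) = A + C + E + (B + D + F).
  by rewrite (addrACA A B C D) (addrACA (A + C)).
elim/tau_ind: a => [|a a' Ha Ha'|r1 x1 v1 u1].
- by rewrite !(tau_lie0l, tau_lie0r) !addr0.
- by rewrite !(tau_lie_addl, tau_lie_addr) addr6 Ha Ha' addr0.
elim/tau_ind: b => [|b b' Hb Hb'|r2 x2 v2 u2].
- by rewrite !(tau_lie0l, tau_lie0r) !addr0.
- by rewrite !(tau_lie_addl, tau_lie_addr) addr6 Hb Hb' addr0.
elim/tau_ind: c => [|c c' Hc Hc'|r3 x3 v3 u3].
- by rewrite !(tau_lie0l, tau_lie0r) !addr0.
- by rewrite !(tau_lie_addl, tau_lie_addr) addr6 Hc Hc' addr0.
rewrite !tau_lie_homog !kvecD.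
have -> : r2 + (r3 + r1) = r1 + (r2 + r3) by rewrite addrA addrC.
have -> : r3 + (r1 + r2) = r1 + (r2 + r3) by rewrite addrC addrA.
rewrite !homogD.
have dB (p q m : rV) : dot (p - q) m = dot p m - dot q m.
  by rewrite -scaleN1r addrC dotDl mulN1r addrC.
set X := (X in homog _ X); set U := (U in homog _ _ _ U).
have -> : X = 0.
  rewrite /X -!scaleN1r !(lie_addr, lie_scaler) !scaleN1r.
  rewrite !(dot_addr, dot_scalel, dB).
  have jac := lie_jacobi x1 x2 x3.
  have J1 : lie x1 (lie x2 x3) = - lie x2 (lie x3 x1) - lie x3 (lie x1 x2).
    by apply/eqP; rewrite -opprD -addr_eq0 addrA; apply/eqP.
  rewrite J1 (lieC x2 x1) (lieC x1 x3) (lieC x3 x2).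
  move: (lie x2 (lie x3 x1)) (lie x3 (lie x1 x2)) => p q.
  move: (lie x1 x2) (lie x2 x3) (lie x3 x1) => l12 l23 l31.
  have [M [ME M0 MD MN MZ]] := lin_indet [:: x1; x2; x3; l12; l23; l31; p; q].
  have /= E1 := ME (@Ordinal 8 0 isT); have /= E2 := ME (@Ordinal 8 1 isT).
  have /= E3 := ME (@Ordinal 8 2 isT); have /= E4 := ME (@Ordinal 8 3 isT).
  have /= E5 := ME (@Ordinal 8 4 isT); have /= E6 := ME (@Ordinal 8 5 isT).
  have /= E7 := ME (@Ordinal 8 6 isT); have /= E8 := ME (@Ordinal 8 7 isT).
  rewrite {}E1 {}E2 {}E3 {}E4 {}E5 {}E6 {}E7 {}E8.
  rewrite !(MZ, MN, MD) -[RHS]M0; congr M.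
  by apply/rowP => i; rewrite !mxE; ring.
have -> : U = 0.
  rewrite /U !(dot_addr, dot_scalel, dB).
  by apply/rowP => i; rewrite !mxE; ring.
rewrite -!kvecD.
pose d (u : rV) r := dot u (kv r).
pose a := d u1 r2; pose b := d u2 r3; pose c := d u3 r1.
pose a' := d u2 r1; pose b' := d u3 r2; pose c' := d u1 r3.
pose e1 := d u1 r1; pose e2 := d u2 r2; pose e3 := d u3 r3.
apply: (@homog0 K n g form c1 c2 _ _ (form x1 (lie x2 x3)
  + (form x2 x3 * a + form x3 x1 * b + form x1 x2 * c)
  + c1 * (a' * b' * c' - a * b * c - a * b * b' - b * c * c' - c * a * a')
  + c2 * (a * e2 * e3 + b * e3 * e1 + c * e1 * e2))).
have fD y z w : form w (y + z) = form w y + form w z.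
  by rewrite inv_formC -[y]scale1r inv_formDl mul1r scale1r !(inv_formC _ w).
have f0 w : form w 0 = 0.
  by apply: (addIr (form w 0)); rewrite -fD addr0 add0r.
have fZ t y w : form w (t *: y) = t * form w y.
  by rewrite (inv_formC _ w) -[t *: y]addr0 inv_formDl !(inv_formC _ _ w) f0 addr0.
have F2 : form x2 (lie x3 x1) = form x1 (lie x2 x3).
  by rewrite -inv_formA inv_formC.
have F3 : form x3 (lie x1 x2) = form x1 (lie x2 x3).
  by rewrite inv_formC inv_formA.
rewrite -!scaleN1r !(fD, fZ) F2 F3 !(dot_addr, dot_addl, dot_scalel, dot_scaler, kvecD).
rewrite (inv_formC _ x2 x1) (inv_formC _ x3 x2) (inv_formC _ x1 x3).
rewrite /a /b /c /a' /b' /c' /e1 /e2 /e3 /d.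
apply/rowP => i; rewrite !mxE.
move: (kv r1) (kv r2) (kv r3) => k1 k2 k3.
ring.
Qed.

End ToroidalLie.

HB.instance Definition _ (K : numFieldType) n (g : lieAlgType K)
  (form : invForm g) (c1 c2 : K) :=
  isLieAlgebra.Build K (tau n form c1 c2) (@tau_lieDl K n g form c1 c2)
    (@tau_lieDr K n g form c1 c2) (@tau_liexx K n g form c1 c2)
    (@tau_lie_jacobi K n g form c1 c2).

Section ChangeOfCoordinates.
Variables (K : numFieldType) (n : nat) (g : lieAlgType K) (form : invForm g).
Variables (c1 c2 : K).
Local Notation rV := 'rV[K]_n.+1.
Local Notation kv := (@kvec K n).
Local Notation tau := (tau n form c1 c2).
Local Notation homog := (@homog K n g form c1 c2).

Definition map_laurent (E : lmodType K) (B : 'M[int]_n.+1) (h : E -> E)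
  (f : laurent n E) : laurent n E := lext (fun m x => mono (m *m B^T) (h x)) f.

Definition twistOmega (B : 'M[int]_n.+1) : Omega K n -> Omega K n :=
  map_laurent B (fun v => v *m (map_mx intr B)^T).

(* T_B *)
Definition twist (B : 'M[int]_n.+1) (a : tau) : tau :=
  let: (f, z, w) := a in
  (map_laurent B id f,
   toZ (twistOmega B (repr z)),
   map_laurent B (fun u : rV => u *m map_mx intr (invmx B)) w).

Lemma map_laurentP (E : lmodType K) B (h : E -> E) : linear h ->
  linear (map_laurent B h) *
  (forall k x, map_laurent B h (mono k x) = mono (k *m B^T) (h x)).
Proof.
move=> hl; split=> [|k x].
  by apply: lext_lin => k a x y; rewrite hl linearP.
apply: lext_mono => j; rewrite -[h 0]/(h 0).
have -> : h 0 = 0 by have := hl (-1) 0 0; rewrite scaler0 addr0 scaleN1r addNr.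
by rewrite linear0.
Qed.

Lemma kvecM k (B : 'M[int]_n.+1) : kv (k *m B^T) = kv k *m (map_mx intr B)^T.
Proof. by rewrite /kvec map_mxM map_trmx. Qed.

Lemma twistOmega_dA B x : x \in @dA K n -> twistOmega B x \in @dA K n.
Proof.
have [tl tm] : linear (twistOmega B) * (forall k x, twistOmega B (mono k x) =
    mono (k *m B^T) (x *m (map_mx intr B)^T)).
  by apply: map_laurentP => a y z; rewrite mulmxDl scalemxAl.
pose T := GRing.isLinear.Build K (Omega K n) (Omega K n) *:%R (twistOmega B) tl.
pose TL : {linear Omega K n -> Omega K n} := HB.pack (twistOmega B) T.
move=> /asboolP[a ->]; have [A aA] := supp_exists a.
rewrite (laurent_decomp aA) linear_sum -[twistOmega B]/(TL : _ -> _) linear_sum.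
rewrite rpred_sum // => k _ /=; rewrite /dOmega lext_mono; last first.
  by move=> j; rewrite scale0r linear0.
by rewrite tm -scalemxAl -kvecM dA_mono.
Qed.

Lemma twistZE B x : toZ (twistOmega B (repr (toZ x))) = toZ (twistOmega B x).
Proof.
have [tl _] : linear (twistOmega B) * (forall k x, twistOmega B (mono k x) =
    mono (k *m B^T) (x *m (map_mx intr B)^T)).
  by apply: map_laurentP => a y z; rewrite mulmxDl scalemxAl.
apply/toZ_eq; rewrite -scaleN1r addrC -tl twistOmega_dA // addrC scaleN1r.
by apply/toZ_eq; rewrite toZK.
Qed.

Lemma twist_homog B k x v u : twist B (homog k x v u) =
  homog (k *m B^T) x (v *m (map_mx intr B)^T) (u *m map_mx intr (invmx B)).
Proof.
rewrite /twist /homog twistZE /twistOmega.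
have mull p (A : 'M[K]_p) : linear (fun y : 'rV_p => y *m A).
  by move=> a y z; rewrite mulmxDl scalemxAl.
by rewrite (map_laurentP _ (mull _ _)).2 (map_laurentP _ (mull _ _)).2
  (@map_laurentP _ _ id _).2.
Qed.

Lemma twist_lin B : linear (twist B).
Proof.
move=> a [[x1 x2] x3] [[y1 y2] y3].
rewrite -[X in twist _ X]/((a *: x1 + y1, a *: x2 + y2, a *: x3 + y3) : tau).
have mull p (A : 'M[K]_p) : linear (fun y : 'rV_p => y *m A).
  by move=> b y z; rewrite mulmxDl scalemxAl.
rewrite /twist (@map_laurentP _ B id _).1 // (map_laurentP _ (mull _ _)).1.
have tl : linear (twistOmega B) by apply: (map_laurentP _ (mull _ _)).1.
congr (_, _, _).
have [[p ->] [q ->]] : (exists p, x2 = toZ p) /\ (exists q, y2 = toZ q).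
  by split; [exists (repr x2)|exists (repr y2)]; rewrite toZK.
rewrite -(toZ_lin a p q) (twistZE B p) (twistZE B q) (twistZE B (a *: p + q)).
by rewrite (tl a p q); apply: toZ_lin.
Qed.

Lemma dot_twist (B : 'M[int]_n.+1) (u : rV) k : B \in unitmx ->
  dot (u *m map_mx intr (invmx B)) (kv (k *m B^T)) = dot u (kv k).
Proof.
move=> Bu; have dotE (x y : rV) : dot x y = (x *m y^T) 0 0.
  by rewrite /dot mxE; apply: eq_bigr => i _; rewrite mxE.
by rewrite !dotE kvecM trmx_mul trmxK mulmxA -(mulmxA u) -map_mxM mulVmx //
  map_mx1 mulmx1.
Qed.

Lemma twist_lie (B : 'M[int]_n.+1) a b : B \in unitmx ->
  twist B (lie a b) = lie (twist B a) (twist B b).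
Proof.
move=> Bu; have tD x y : twist B (x + y) = twist B x + twist B y.
  by have := twist_lin B 1 x y; rewrite !scale1r.
have t0 : twist B 0 = 0.
  by have := twist_lin B (-1) 0 0; rewrite scaler0 addr0 scaleN1r addNr.
elim/tau_ind: a => [|a a' Ha Ha'|r x v u].
- by rewrite !(lie0l, t0).
- by rewrite !(lie_addl, tD) Ha Ha'.
elim/tau_ind: b => [|b b' Hb Hb'|s y w z].
- by rewrite !(lie0r, t0).
- by rewrite !(lie_addr, tD) Hb Hb'.
have lieE (x1 y1 : tau) : lie x1 y1 = tau_lie x1 y1 by [].
rewrite !lieE !twist_homog !tau_lie_homog twist_homog mulmxDl !dot_twist //.
have dB p (q : rV) : dot (p *m map_mx intr (invmx B)) (q *m (map_mx intr B)^T)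
    = dot p q.
  have dotE (x' y' : rV) : dot x' y' = (x' *m y'^T) 0 0.
    by rewrite /dot mxE; apply: eq_bigr => i _; rewrite mxE.
  by rewrite !dotE trmx_mul trmxK mulmxA -(mulmxA p) -map_mxM mulVmx //
    map_mx1 mulmx1.
rewrite !dB !kvecM; congr homog.
  by rewrite !(mulmxDl, mulNmx, scalemxAl).
by rewrite !(mulmxDl, mulNmx, scalemxAl).
Qed.

End ChangeOfCoordinates.

Section Modules.
Variables (K : numFieldType) (L : lieAlgType K) (V : lmodType K).
Variable rho : L -> V -> V.

Record lie_action : Prop := LieAction {
  actDl : forall a x y v, rho (a *: x + y) v = a *: rho x v + rho y v;
  actDr : forall a x v w, rho x (a *: v + w) = a *: rho x v + rho x w;
  act_lie : forall x y v, rho (lie x y) v = rho x (rho y v) - rho y (rho x v)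
}.

Definition submodule (W : set V) : Prop :=
  [/\ W 0, forall a v w, W v -> W w -> W (a *: v + w) &
      forall x v, W v -> W (rho x v)].

Definition irreducible_action : Prop :=
  (exists v : V, v <> 0) /\
  forall W, submodule W -> W = [set 0] \/ W = setT.

Definition nontrivial_action : Prop := ~ forall x v, rho x v = 0.

End Modules.

(* W, assumed to be a subspace, has a basis of d vectors. *)
Definition has_dim (K : numFieldType) (V : lmodType K) (W : set V) (d : nat) :=
  exists b : 'I_d -> V, (forall i, W (b i)) /\
    forall v, W v -> exists! c : 'rV[K]_d, v = \sum_i c 0 i *: b i.

Section ToroidalModules.
Variables (K : numFieldType) (n : nat) (g : lieAlgType K) (form : invForm g).
Variables (c1 c2 : K).
Local Notation tau := (tau n form c1 c2).
Local Notation homog := (@homog K n g form c1 c2).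

(* t^r d_i *)
Definition tau_d (r : expo n) (i : 'I_n.+1) : tau :=
  homog r 0 0 (delta_mx 0 i).

Definition graded_part (k : expo n) : set tau :=
  [set a | exists x v u, a = homog k x v u].

Variables (V : lmodType K) (rho : tau -> V -> V).

(* A functional mu in D^* is given by the row of its values mu(d_i); then
   kvec m is the functional identified with m. *)
Definition weight_space (mu : 'rV[K]_n.+1) : set V :=
  [set v | forall i, rho (tau_d 0 i) v = mu 0 i *: v].

(* V is the direct sum of the V_(lambda + m). *)
Definition weight_decomposition (lambda : 'rV[K]_n.+1) : Prop :=
  forall v, exists! f : laurent n V,
    (forall m, weight_space (lambda + kvec K m) (f m)) /\
    v = \sum_(m \in [set: expo n]) f m.

Definition harish_chandra_at (lambda : 'rV[K]_n.+1) : Prop :=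
  weight_decomposition lambda /\
  forall m, exists d, has_dim (weight_space (lambda + kvec K m)) d.

Definition harish_chandra : Prop := exists lambda, harish_chandra_at lambda.

Definition cuspidal : Prop :=
  exists lambda, harish_chandra_at lambda /\
    exists N, forall m, exists d,
      (d <= N)%N /\ has_dim (weight_space (lambda + kvec K m)) d.

Definition GHW_module (Lambda0 : 'rV[K]_n.+1) : Prop :=
  exists v, v <> 0 /\ weight_space Lambda0 v /\
    exists p : nat, (0 < p)%N /\
      forall k : expo n, (forall i, p%:Z <= k 0 i) ->
        forall a, graded_part k a -> rho a v = 0.

End ToroidalModules.

(* Main.v *)
Require Import Defs.
From mathcomp Require Import all_boot all_order all_algebra.
From mathcomp Require Import all_classical all_reals.
From mathcomp Require Import complex zify ring.
Set Implicit Arguments. Unset Strict Implicit. Unset Printing Implicit Defensive.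
Import Order.TTheory GRing.Theory Num.Theory VectorInternalTheory.
Local Open Scope ring_scope.

(** The theorem is a dimension count followed by lattice geometry.

    Suppose the weight multiplicities of V are unbounded, and fix the weights
    lambda + e with e in the box of all integer vectors with coordinates
    between -2 and 2. For a weight lambda - m of large enough multiplicity, the
    finitely many maps V_(lambda - m) -> V_(lambda + e) given by bases of the
    homogeneous components of degree m + e have a common kernel vector v <> 0
    ([common_kernel]), and m lies outside the box because the weights in the box
    have multiplicities below the bound.

    The set G of all degrees r such that the whole component of degree r kills v
    is closed under sums of linearly independent degrees, since the bracket of
    two such components is the full component of the sum
    ([graded_kills_minor]). As G contains m + e for all e in the box, it
    contains M m + s for all M >= 1 and all s with coordinates at most M in
    absolute value ([dilated_box_closed]): G contains a full-dimensional cone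
    around the ray of m.

    It remains to find a basis of the lattice whose positive combinations stay
    in that cone. Because the rank n + 1 is at least 2, some basis f_0, ..., f_n
    gives m coordinates of sum zero; then f_i |-> f_i + N m is a transvection,
    so the vectors f_i + N m form a basis too ([transvection_basis]). For N
    larger than the entries of the f_i, a positive combination of them with
    coefficients of sum S is S N m plus a vector of size at most S N
    ([transvection_cone]). In the coordinates of this basis v is a generalized
    highest weight vector, with p = 1. *)

(** * Geometry of the lattice *)

(** By induction on N: m (N+2) + s is split as the sum of m + e, with e a
    truncation of s to the box, and of an element covered by the induction
    hypothesis. The i-th coordinate of the total is nonzero since |m_i| >= 2, so
    for a given e_i only one value of e_j makes the (i, j) minor of the summands
    vanish; the box of radius 2 leaves two consecutive values of e_j. *)
Lemma dilated_box_closed n (G : expo n -> Prop) (m : expo n) (i j : 'I_n.+1) :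
  i != j -> 2 <= `|m 0 i| ->
  (forall r s : expo n, r 0 i * s 0 j != r 0 j * s 0 i ->
    G r -> G s -> G (r + s)) ->
  (forall e : expo n, (forall l, `|e 0 l| <= 2) -> G (m + e)) ->
  forall N (s : expo n), (forall l, `|s 0 l| <= N.+1%:Z) -> G (m *+ N.+1 + s).
Proof.
move=> ij m2 GD Gm; elim=> [|N IH] s sN.
  by apply: Gm => l; apply: le_trans (sN l) _.
(* b selects one of two admissible values of the j-th coordinate. *)
pose e (b : bool) : expo n :=
  \row_l (Num.max (-2) (Num.min 1 (s 0 l)) + (b && (l == j))%:R).
have e2 b l : `|e b 0 l| <= 2.
  by rewrite mxE; case: (b && _) => /=; lia.
have rN b l : `|(s - e b) 0 l| <= N.+1%:Z.
  by have := sN l; rewrite !mxE; case: (b && _) => /=; lia.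
have sumE b : m *+ N.+2 + s = (m *+ N.+1 + (s - e b)) + (m + e b).
  by rewrite addrACA subrK -mulrSr.
have minor : exists b, (m *+ N.+1 + (s - e b)) 0 i * (m + e b) 0 j
    != (m *+ N.+1 + (s - e b)) 0 j * (m + e b) 0 i.
  have mulN (l : 'I_n.+1) : (m *+ N.+1) 0 l = N.+1%:Z * m 0 l.
    by rewrite mulmxnE -mulr_natl natz.
  have [E|] := eqVneq ((m *+ N.+1 + (s - e false)) 0 i * (m + e false) 0 j)
     ((m *+ N.+1 + (s - e false)) 0 j * (m + e false) 0 i); last by exists false.
  exists true; apply/eqP => E'; move: (sN i) E E'.
  rewrite !mxE !mulN !eqxx (negPf ij) /=.
  move: (Num.max _ (Num.min _ (s 0 i))) (Num.max _ (Num.min _ (s 0 j))) => x y.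
  move: (s 0 i) (s 0 j) => si sj sM E E'.
  have : N.+1%:Z * m 0 i + m 0 i + si = 0.
    (* The two minors differ by the i-th coordinate of the total degree. *)
    have <- : (N.+1%:Z * m 0 i + (si - (x + 0))) * (m 0 j + (y + 1))
      - (N.+1%:Z * m 0 j + (sj - (y + 1))) * (m 0 i + (x + 0))
      - ((N.+1%:Z * m 0 i + (si - (x + 0))) * (m 0 j + (y + 0))
      - (N.+1%:Z * m 0 j + (sj - (y + 0))) * (m 0 i + (x + 0)))
      = N.+1%:Z * m 0 i + m 0 i + si by ring.
    by rewrite E E' !subrr.
  nia.
by have [b mb] := minor; rewrite (sumE b); apply: GD => //; [apply: IH|apply: Gm].
Qed.

(** Let u be the column of ones. If m = c P with P unimodular and c u = 0, then
    the matrix is (1 + N u c) P and u c has square zero. Smith's normal form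
    gives m = (a, 0, ..., 0) Q; one elementary operation turns the coordinates
    into (a, -a, 0, ..., 0), which is where rank at least 2 enters. *)
Lemma transvection_basis n (m : expo n) : (1 <= n)%N ->
  exists P : 'M[int]_n.+1, forall N : int,
    P + N *: (const_mx 1 *m m) \in unitmx.
Proof.
move=> n1; have [L _ [Q Qu [d _ mE]]] := int_Smith_normal_form m.
pose a : int := L 0 0 * d`_0.
pose o : 'I_n.+1 := inord 1.
have o0 : o != 0 by rewrite -val_eqE /= inordK.
have {}mE : m = (a *: delta_mx 0 0) *m Q.
  rewrite mE; congr (_ *m Q); apply/rowP => j.
  rewrite !mxE big_ord_recl big_ord0 addr0 !mxE eqxx /a.
  by rewrite (eq_sym j) -val_eqE /=; case: eqP => _; rewrite (mulr0n,mulr1n) ?mulr0 ?mulr1.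
pose c : expo n := a *: (delta_mx 0 0 - delta_mx 0 o).
pose F : 'M[int]_n.+1 := 1%:M + delta_mx 0 o.
exists (F *m Q) => N.
have FF : F *m (1%:M - delta_mx 0 o) = 1%:M.
  rewrite /F mulmxDl !mulmxBr !mulmx1 mul1mx mul_delta_mx_0 // subr0.
  by rewrite subrK.
have Fu : F \in unitmx by case: (mulmx1_unit FF).
have mP : m = c *m (F *m Q).
  rewrite {1}mE mulmxA; congr (_ *m Q).
  rewrite /c /F -scalemxAl mulmxDr mulmx1 mulmxBl mul_delta_mx.
  by rewrite mul_delta_mx_0 // subr0 subrK.
have c1 : c *m (const_mx 1 : 'cV_n.+1) = 0.
  rewrite /c -scalemxAl mulmxBl -!rowE; apply/rowP => j.
  by rewrite !mxE subrr mulr0.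
rewrite {1}mP mulmxA scalemxAl -{1}[F *m Q]mul1mx -mulmxDl.
set X := N *: _.
have XX : X *m X = 0.
  by rewrite /X -scalemxAl -scalemxAr mulmxA -(mulmxA _ c) c1 mulmx0 mul0mx !scaler0.
have Xu : (1%:M + X) *m (1%:M - X) = 1%:M.
  by rewrite mulmxDl !mulmxBr !mulmx1 mul1mx XX subr0 subrK.
by rewrite !unitmx_mul Fu Qu (mulmx1_unit Xu).1.
Qed.

(** N dominates the entries of P, so k P has coordinates at most (\sum_i k_i) N,
    which is also the multiplicity of m. *)
Lemma transvection_cone n (P : 'M[int]_n.+1) :
  exists N : int, forall (m k : expo n), (forall i, 1 <= k 0 i) ->
    exists M (s : expo n), (forall l, `|s 0 l| <= M.+1%:Z) /\
      k *m (P + N *: (const_mx 1 *m m)) = m *+ M.+1 + s.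
Proof.
pose N := (\sum_i \sum_j absz (P i j)).+1; exists N%:Z => m k k1.
have PN i j : `|P i j| <= N%:Z.
  rewrite -abszE lez_nat /N (bigD1 i) //= (bigD1 j) //= -addnA.
  exact: leqW (leq_addr _ _).
pose S := \sum_i k 0 i.
have S1 : 1 <= S.
  rewrite /S big_ord_recl ler_wpDr //; apply: sumr_ge0 => i _.
  exact: le_trans (k1 _).
have [M ME] : exists M : nat, S * N%:Z = M.+1%:Z.
  exists (absz (S * N%:Z)).-1; rewrite /N in PN *; nia.
exists M, (k *m P); split=> [l|].
  rewrite -ME mxE mulr_suml; apply: le_trans (ler_norm_sum _ _ _) _.
  apply: ler_sum => i _; rewrite normrM ger0_norm ?(le_trans _ (k1 i)) //.
  by rewrite ler_wpM2l ?(le_trans _ (k1 i)).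
rewrite mulmxDr addrC -scalemxAr mulmxA; congr (_ + _).
have -> : k *m (const_mx 1 : 'cV_n.+1) = S%:M.
  apply/rowP => j; rewrite !mxE ord1 eqxx mulr1n.
  by apply: eq_bigr => i _; rewrite mxE mulr1.
by rewrite mul_scalar_mx scalerA mulrC ME -scaler_nat natz.
Qed.

(** The box of [dilated_box_closed], as a finite index type for the sum over its
    points in [common_kernel]. *)
Definition offset n (f : {ffun 'I_n.+1 -> 'I_5}) : expo n :=
  \row_l ((f l)%:Z - 2).

Lemma offset_surj n (e : expo n) : (forall l, `|e 0 l| <= 2) ->
  exists f, e = offset f.
Proof.
move=> e2; exists [ffun l => inord (absz (e 0 l + 2))]; apply/rowP => l.
rewrite mxE ffunE inordK; have := e2 l; lia.
Qed.

(** * Degrees annihilating a vector *)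

Section Action.
Variables (K : numFieldType) (n : nat) (g : fdLieAlgType K) (form : invForm g).
Variables (c1 c2 : K).
Local Notation tau := (tau n form c1 c2).
Local Notation homog := (@homog K n g form c1 c2).
Variables (V : lmodType K) (rho : tau -> V -> V).
Hypothesis rhoP : lie_action rho.

Definition graded_kills (v : V) (r : expo n) : Prop :=
  forall a, graded_part r a -> rho a v = 0.

Lemma act0l v : rho 0 v = 0.
Proof.
by have := actDl rhoP (-1) 0 0 v; rewrite scaler0 addr0 scaleN1r addNr.
Qed.

Lemma act0r x : rho x 0 = 0.
Proof.
by have := actDr rhoP (-1) x 0 0; rewrite scaler0 addr0 scaleN1r addNr.
Qed.

Lemma act_suml (I : finType) (f : I -> tau) (a : I -> K) v :
  rho (\sum_i a i *: f i) v = \sum_i a i *: rho (f i) v.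
Proof.
elim/big_rec2: _ => [|i y x _ <-]; first exact: act0l.
exact: (actDl rhoP).
Qed.

Lemma form0l x : form 0 x = 0.
Proof.
by have := inv_formDl form (-1) 0 0 x; rewrite scaler0 addr0 mulN1r addNr.
Qed.

(** Brackets with the single derivation b t^r suffice. Writing b(s) for dot b s,
    they send w in the central part of degree s to b(s) w + b(w) r in the
    central part of degree r + s: the choice w = r isolates the direction r, and
    all w follow since b(s) <> 0. The part in g is multiplied by b(s). The
    derivation z of degree s is sent to b(s) z - z(r) b modulo the central part,
    and the choice z = b isolates b. *)
Lemma graded_kills_add v (r s : expo n) (b : 'rV[K]_n.+1) :
  dot b (kvec K r) = 0 -> dot b (kvec K s) != 0 ->
  graded_kills v r -> graded_kills v s -> graded_kills v (r + s).
Proof.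
set D := dot b (kvec K s) => br bs kr ks.
have brk y w z : rho (lie (homog r 0 0 b) (homog s y w z)) v = 0.
  rewrite (act_lie rhoP) (kr (homog r 0 0 b)) ?(ks (homog s y w z)) ?act0r ?subr0 //.
    by exists y, w, z.
  by exists 0, 0, b.
have brE y w z : lie (homog r 0 0 b) (homog s y w z) =
    tau_lie (homog r 0 0 b) (homog s y w z) by [].
have comb a x y : rho x v = 0 -> rho (a *: x + y) v = 0 -> rho y v = 0.
  by rewrite (actDl rhoP) => ->; rewrite scaler0 add0r.
have killD x : rho (D *: x) v = 0 -> rho x v = 0.
  rewrite -[D *: x]addr0 (actDl rhoP) act0l addr0 => /eqP.
  by rewrite scaler_eq0 (negPf bs) => /eqP.
have killK w : rho (homog (r + s) 0 w 0) v = 0.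
  have K1 w' : rho (homog (r + s) 0 (D *: w' + dot b w' *: kvec K r) 0) v = 0.
    rewrite -(brk 0 w' 0) brE tau_lie_homog.
    by rewrite !(form0l, dot0l, lie0l, mulr0, oppr0, scale0r, scaler0, addr0, add0r).
  have Kr : rho (homog (r + s) 0 (kvec K r) 0) v = 0.
    apply: killD; rewrite homogZ !scaler0 -(K1 (kvec K r)).
    by rewrite br scale0r addr0.
  apply: killD; apply: (comb (dot b w) _ _ Kr).
  by rewrite !homogZ !scaler0 homogD !addr0 (addrC (_ *: kvec K r)) K1.
have killg y : rho (homog (r + s) y 0 0) v = 0.
  apply: killD; rewrite homogZ !scaler0 -(brk y 0 0) brE tau_lie_homog.
  by rewrite !(form0l, dot0l, dot0r, lie0l, mulr0, oppr0, scale0r, scaler0, addr0, add0r).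
have killW z : rho (homog (r + s) 0 0 z) v = 0.
  have W1 z' : rho (homog (r + s) 0 0 (D *: z' - dot z' (kvec K r) *: b)) v = 0.
    have := brk 0 0 z'; rewrite brE tau_lie_homog.
    rewrite lie0l !scaler0 !subr0 addr0 -/D.
    set k := (X in homog _ 0 X _).
    set u := (X in homog _ _ _ X).
    have -> : homog (r + s) 0 k u = 1 *: homog (r + s) 0 k 0 + homog (r + s) 0 0 u.
      by rewrite scale1r homogD !addr0 add0r.
    by apply: comb; apply: killK.
  have Wb : rho (homog (r + s) 0 0 b) v = 0.
    by apply: killD; rewrite homogZ !scaler0 -(W1 b) br scale0r subr0.
  apply: killD; apply: (comb (- dot z (kvec K r)) _ _ Wb).
  by rewrite !homogZ !scaler0 homogD !addr0 (addrC (_ *: b)) scaleNr W1.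
move=> _ [x [w [u ->]]].
have -> : homog (r + s) x w u = 1 *: homog (r + s) x 0 0 +
  (1 *: homog (r + s) 0 w 0 + homog (r + s) 0 0 u).
  by rewrite !scale1r !homogD !addr0 !add0r.
by rewrite !(actDl rhoP) killg killK killW !scaler0 !addr0.
Qed.

(** The functional k |-> r_i k_j - r_j k_i vanishes at r, and at s it is the
    given minor. *)
Lemma graded_kills_minor v (r s : expo n) (i j : 'I_n.+1) :
  r 0 i * s 0 j != r 0 j * s 0 i ->
  graded_kills v r -> graded_kills v s -> graded_kills v (r + s).
Proof.
move=> minor.
pose b : 'rV[K]_n.+1 := (r 0 i)%:~R *: delta_mx 0 j - (r 0 j)%:~R *: delta_mx 0 i.
have dotE k : dot b (kvec K k) = (r 0 i * k 0 j - r 0 j * k 0 i)%:~R.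
  have dd l : dot (delta_mx 0 l) (kvec K k) = (k 0 l)%:~R.
    rewrite /dot (bigD1 l) //= big1 ?addr0 => [|p pl].
      by rewrite !mxE !eqxx mul1r.
    by rewrite mxE (negPf pl) andbF mul0r.
  rewrite /b -scaleNr dotDl dot_scalel !dd intrB !intrM.
  by rewrite mulNr.
apply: (@graded_kills_add _ _ _ b); rewrite dotE.
  by rewrite mulrC subrr.
by rewrite intr_eq0 subr_eq0.
Qed.

Lemma tau_d0_lie i (r : expo n) x v u :
  lie (tau_d form c1 c2 0 i) (homog r x v u) = (r 0 i)%:~R *: homog r x v u.
Proof.
have kv0 : kvec K (0 : expo n) = 0 by apply/rowP => l; rewrite !mxE.
have dd : dot (delta_mx 0 i) (kvec K r) = (r 0 i)%:~R.
  rewrite /dot (bigD1 i) //= big1 ?addr0 => [|p pl].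
    by rewrite !mxE !eqxx mul1r.
  by rewrite mxE (negPf pl) andbF mul0r.
rewrite -[lie _ _]/(tau_lie (homog 0 0 0 (delta_mx 0 i)) (homog r x v u)).
rewrite tau_lie_homog homogZ.
by rewrite !(form0l, kv0, dd, dot0r, lie0l, scaler0, scale0r, mul0r, oppr0, subr0, addr0, add0r).
Qed.

Lemma graded_part_weight (r : expo n) a mu v : graded_part r a ->
  weight_space rho mu v -> weight_space rho (mu + kvec K r) (rho a v).
Proof.
move=> [x [w [u ->]]] wv i.
have := act_lie rhoP (tau_d form c1 c2 0 i) (homog r x w u) v.
rewrite tau_d0_lie wv.
rewrite -[(r 0 i)%:~R *: _]addr0 (actDl rhoP) act0l addr0.
have -> : rho (homog r x w u) (mu 0 i *: v) = mu 0 i *: rho (homog r x w u) v.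
  by rewrite -[mu 0 i *: v]addr0 (actDr rhoP) act0r addr0.
move/eqP; rewrite eq_sym subr_eq => /eqP ->.
by rewrite -scalerDl !mxE addrC.
Qed.

(** Linear coordinates on the homogeneous component of degree r; for r <> 0
    they are redundant on the K_i part, as sum_i r_i t^r K_i vanishes. *)
Definition graded_vec (r : expo n)
    (y : 'rV[K]_(dim g + (n.+1 + n.+1))) : tau :=
  homog r (r2v (lsubmx y)) (lsubmx (rsubmx y)) (rsubmx (rsubmx y)).

Lemma graded_vec_decomp r y :
  graded_vec r y = \sum_i y 0 i *: graded_vec r (delta_mx 0 i).
Proof.
have lin a y1 y2 : graded_vec r (a *: y1 + y2) =
    a *: graded_vec r y1 + graded_vec r y2.
  by rewrite /graded_vec homogZ homogD; congr homog; rewrite !linearP.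
have g0 : graded_vec r 0 = 0.
  by have := lin (-1) 0 0; rewrite scaler0 addr0 scaleN1r addNr.
rewrite {1}(row_sum_delta y); elim/big_rec2: _ => // i a b _ <-.
exact: lin.
Qed.

Lemma graded_kills_basis v r :
  (forall i, rho (graded_vec r (delta_mx 0 i)) v = 0) -> graded_kills v r.
Proof.
move=> kv _ [x [w [u ->]]].
have -> : homog r x w u = graded_vec r (row_mx (v2r x) (row_mx w u)).
  by rewrite /graded_vec !(row_mxKl, row_mxKr) v2rK.
by rewrite graded_vec_decomp act_suml big1 // => i _; rewrite kv scaler0.
Qed.


Lemma weight_space_lin mu a v w : weight_space rho mu v ->
  weight_space rho mu w -> weight_space rho mu (a *: v + w).
Proof.
by move=> wv ww i; rewrite (actDr rhoP) wv ww scalerDr !scalerA mulrC.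
Qed.

Lemma weight_space0 mu : weight_space rho mu 0.
Proof. by move=> i; rewrite act0r scaler0. Qed.

Lemma homog0_act mu v u : weight_space rho mu v ->
  rho (homog 0 0 0 u) v = dot u mu *: v.
Proof.
move=> wv.
have -> : homog 0 0 0 u = \sum_l u 0 l *: tau_d form c1 c2 0 l.
  rewrite {1}(row_sum_delta u); elim/big_rec2: _ => [|l a w _ <-].
    by rewrite /homog !linear0.
  by rewrite homogZ homogD !scaler0 !addr0.
rewrite act_suml /dot scaler_suml; apply: eq_bigr => l _.
by rewrite wv scalerA.
Qed.

End Action.

(** * Dimension count and conclusion *)

(** The coordinates of all the T i together form one linear map from a space of
    dimension d to a space of dimension \sum_i D i < d. *)
Lemma common_kernel (K : numFieldType) (V : lmodType K) (W : set V) d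
    (I : finType) (T : I -> V -> V) (U : I -> set V) (D : I -> nat) :
  (forall i a v w, T i (a *: v + w) = a *: T i v + T i w) ->
  (forall a v w, W v -> W w -> W (a *: v + w)) -> W 0 ->
  has_dim W d -> (forall i, has_dim (U i) (D i)) ->
  (forall i v, W v -> U i (T i v)) ->
  (\sum_i D i < d)%N ->
  exists v, [/\ v <> 0, W v & forall i, T i v = 0].
Proof.
move=> Tlin WD W0 [b [bW bfree]] Udim TU Dd.
have T0 i : T i 0 = 0.
  by have := Tlin i (-1) 0 0; rewrite scaler0 addr0 scaleN1r addNr.
have /cid2/= [u _ uP] : exists2 u : forall i, 'I_(D i) -> V, True &
    forall i v, U i v -> exists c : 'rV[K]_(D i), v = \sum_l c 0 l *: u i l.
  have h i : exists u : 'I_(D i) -> V,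
      forall v, U i v -> exists c : 'rV[K]_(D i), v = \sum_l c 0 l *: u l.
    have [u [_ uP]] := Udim i; exists u => v /uP [c [-> _]]; by exists c.
  by exists (fun i => projT1 (cid (h i))) => // i; exact: (projT2 (cid (h i))).
have hA i j := uP i _ (TU i _ (bW j)).
pose A i : 'M[K]_(d, D i) := \matrix_j projT1 (cid (hA i j)).
have AP i j : T i (b j) = \sum_l A i j l *: u i l.
  rewrite {1}(projT2 (cid (hA i j))); apply: eq_bigr => l _.
  by rewrite !mxE.
pose M : 'M[K]_(d, \sum_(k < #|I|) D (enum_val k)) :=
  \mxrow_(k < #|I|) A (enum_val k).
have [x x0 xM] : exists2 x : 'rV[K]_d, x != 0 & x *m M = 0.
  have rM : (\rank M < d)%N.
    apply: leq_ltn_trans (rank_leq_col _) _.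
    by rewrite -(big_enum_val D).
  have /rowV0Pn[x xk x0] : kermx M != 0.
    by rewrite -mxrank_eq0 mxrank_ker subn_eq0 -ltnNge.
  by exists x => //; apply/sub_kermxP.
exists (\sum_j x 0 j *: b j); split.
- move=> s0; case: (bfree 0 W0) => c [cE cU].
  have cx := cU x (esym s0); have c0 := cU 0.
  move: x0; rewrite -cx c0 ?eqxx // big1 // => j _; by rewrite mxE scale0r.
- by elim/big_ind: _ => // [v w Wv Ww|j _]; [rewrite -[v]scale1r|
    rewrite -[_ *: _]addr0]; apply: WD.
- have xAk (k : 'I_#|I|) : x *m A (enum_val k) = 0.
    have := mul_mxrow x (fun k : 'I_#|I| => A (enum_val k)).
    rewrite -/M xM => E; have := congr1 (fun N => submxrow N k) E.
    by rewrite mxrowK => <-; exact: submxrow0.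
  move=> i; have xA : x *m A i = 0.
    by have := xAk (enum_rank i); rewrite enum_rankK.
  have -> : T i (\sum_j x 0 j *: b j) = \sum_j x 0 j *: T i (b j).
    by elim/big_rec2: _ => // j y z _ <-.
  under eq_bigr do rewrite AP scaler_sumr.
  rewrite exchange_big big1 //= => l _.
  under eq_bigr do rewrite scalerA.
  rewrite -scaler_suml.
  have := congr1 (fun N : 'rV_(D i) => N 0 l) xA; rewrite !mxE => ->.
  by rewrite scale0r.
Qed.

Theorem theorem4p3 (R : realType) (n : nat) (n_ge1 : (1 <= n)%N)
    (g : fdLieAlgType R[i]) (g_simple : simple_lie g) (form : invForm g)
    (c1 c2 : R[i]) (V : lmodType R[i]) (rho : tau n form c1 c2 -> V -> V)
    (rhoP : lie_action rho) (rho_nontrivial : nontrivial_action rho)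
    (rho_irr : irreducible_action rho) (rho_HC : harish_chandra rho) :
  cuspidal rho \/
  exists B : 'M[int]_n.+1, B \in unitmx /\
    exists Lambda0, GHW_module (fun x => rho (twist B x)) Lambda0.
Proof.
have [|ncusp] := pselect (cuspidal rho); [by left|right].
have [lam HC] := rho_HC; have [_ HCdim] := HC.
pose W m := weight_space rho (lam + kvec R[i] m).
pose I := ({ffun 'I_n.+1 -> 'I_5} * 'I_(dim g + (n.+1 + n.+1)))%type.
pose D (i : I) := projT1 (cid (HCdim (offset i.1))).
have DP (i : I) : has_dim (W (offset i.1)) (D i).
  exact: (projT2 (cid (HCdim (offset i.1)))).
(* The total dimension of the targets of all maps considered below. *)
pose N := (\sum_i D i)%N.
have [m1 m1big] : exists m1, forall d, (d <= N)%N -> ~ has_dim (W m1) d.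
  apply: contrapT => noM; apply: ncusp; exists lam; split=> //; exists N => m.
  apply: contrapT => nod; apply: noM; exists m => d dN Wd; apply: nod.
  by exists d.
(* Inside the box the dimension of W m1 would be one of the summands of N. *)
have [i mi] : exists i, 2 < `|m1 0 i|.
  apply: contrapT => nomi.
  have [|f fE] := @offset_surj n m1.
    by move=> l; rewrite leNgt; apply/negP => ml; apply: nomi; exists l.
  have q0 : (0 < dim g + (n.+1 + n.+1))%N by rewrite addnA addnS.
  pose i0 : I := (f, Ordinal q0).
  apply: (m1big (D i0)); last by rewrite fE; apply: (DP i0).
  by rewrite /N (bigD1 i0) //= leq_addr.
have [j ij] : exists j, i != j.
  have [->|i0] := eqVneq i 0; last by exists 0.
  by exists (inord 1); rewrite eq_sym -val_eqE /= inordK.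
have [d dimW] := HCdim m1.
have Nd : (N < d)%N by rewrite ltnNge; apply/negP => dN; exact: m1big dN dimW.
pose m := - m1.
have mi2 : 2 <= `|m 0 i| by rewrite mxE normrN ltW.
pose T (i : I) := rho (graded_vec form c1 c2 (m + offset i.1) (delta_mx 0 i.2)).
have [||||v [v0 Wv Tv]] := @common_kernel _ V (W m1) d I T (fun i => W (offset i.1)) D
  _ _ _ dimW DP _ Nd.
- by move=> k a x y; apply: (actDr rhoP).
- by move=> a x y; apply: weight_space_lin.
- exact: weight_space0.
- move=> k x Wx.
  have -> : W (offset k.1) =
      weight_space rho (lam + kvec _ m1 + kvec _ (m + offset k.1)).
    by rewrite -addrA -kvecD /m addNKr.
  by apply: graded_part_weight => //; do 3!eexists.
have Gm (e : expo n) : (forall l, `|e 0 l| <= 2) -> graded_kills rho v (m + e).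
  move=> /offset_surj[f ->]; apply: graded_kills_basis => // k.
  exact: (Tv (f, k)).
have cone := dilated_box_closed ij mi2
  (fun r s => @graded_kills_minor _ _ _ _ _ _ _ _ rhoP v r s i j) Gm.
have [P Pu] := transvection_basis m n_ge1.
have [p pP] := transvection_cone P.
pose B := (P + p *: (const_mx 1 *m m))^T.
exists B; split; first by rewrite unitmx_tr.
exists (\row_l dot (delta_mx 0 l *m map_mx intr (invmx B)) (lam + kvec _ m1)), v.
split=> //; split.
  move=> l; rewrite mxE /tau_d twist_homog !mul0mx.
  exact: homog0_act.
exists 1%N; split=> // k k1 _ [x [w [u ->]]].
rewrite twist_homog /B trmxK.
have [M [s [sM ->]]] := pP m k k1.
by apply: cone => //; do 3!eexists.
Qed.
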